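(* Let $\mathcal{C}$ be a strict Fraïssé class with Fraïssé limit $\mathbf{U}$ such that (1) $\mathcal{C}$ is closed under finite products, (2) $\mathcal{C}$ has the HAP, (3) the coproduct of countably many copies of $\mathbf{U}$ exists in the category of structures in $\overline{\mathcal{C}}$ with all homomorphisms, (4) $\operatorname{End}\mathbf{U}$ is not finitely generated. Then the clone $\operatorname{Pol}\mathbf{U}$ has the Bergman property.
   Context: An embedding is an injective homomorphism reflecting all relations. An age is a class of finitely generated structures of one signature with countably many isomorphism types, closed under finitely generated substructures (up to isomorphism) and with the joint embedding property; $\overline{\mathcal{C}}$ is the class of countable structures all of whose finitely generated substructures are isomorphic to members of $\mathcal{C}$; a Fraïssé class is an age with the amalgamation property, with Fraïssé limit the unique countable homogeneous structure of that age. A Fraïssé class $\mathcal{C}$ is strict if for all $\mathbf{A},\mathbf{B}_1,\mathbf{B}_2\in\mathcal{C}$ and embeddings $f_i:\mathbf{A}\hookrightarrow\mathbf{B}_i$ there exist $\mathbf{C}\in\mathcal{C}$ and homomorphisms $g_i:\mathbf{B}_i\to\mathbf{C}$ forming a pushout of $f_1,f_2$ in the category of structures in $\overline{\mathcal{C}}$ with homomorphisms. HAP: for every embedding $f_1:\mathbf{A}\hookrightarrow\mathbf{B}_1$ and homomorphism $f_2:\mathbf{A}\to\mathbf{B}_2$ in $\mathcal{C}$ there exist $\mathbf{C}\in\mathcal{C}$, an embedding $g_2:\mathbf{B}_2\hookrightarrow\mathbf{C}$ and a homomorphism $g_1:\mathbf{B}_1\to\mathbf{C}$ with $g_1f_1=g_2f_2$.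 $\operatorname{Pol}\mathbf{U}$ is the clone of all homomorphisms $\mathbf{U}^n\to\mathbf{U}$, $\operatorname{End}\mathbf{U}$ its unary part. For sets $U_1,U_2$ of operations, $U_1\cdot U_2=\{f\circ\langle g_1,\dots,g_n\rangle: f\in U_1^{(n)},\ g_j\in U_2^{(m)}\}$; $U^{[k,0]}$ is the set of $k$-ary projections and $U^{[k,i+1]}=U\cdot U^{[k,i]}\cup U^{[k,i]}$. A clone $\mathbb{F}$ has the Bergman property if for every generating set $H$ of $\mathbb{F}$ and every $k\ge1$ there is $n$ with $H^{[k,n]}$ equal to the set of all $k$-ary members of $\mathbb{F}$. *)

(* Defs.v *)
From Stdlib Require Import List.
From Stdlib Require Fin.
Set Implicit Arguments.

Record signature := Signature {
  fsym : Type; farity : fsym -> nat;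
  rsym : Type; rarity : rsym -> nat }.

Record structure (S : signature) := Structure {
  carrier :> Type;
  fint : forall f : fsym S, (Fin.t (farity S f) -> carrier) -> carrier;
  rint : forall r : rsym S, (Fin.t (rarity S r) -> carrier) -> Prop }.
Arguments fint {S} s f _.
Arguments rint {S} s r _.

Section Structures.
Variable S : signature.
Implicit Types A B D U : structure S.

Definition is_hom A B (h : A -> B) : Prop :=
  (forall f a, h (fint A f a) = fint B f (fun i => h (a i))) /\
  (forall r a, rint A r a -> rint B r (fun i => h (a i))).

Arguments is_hom {A B} h.
Definition is_emb A B (h : A -> B) : Prop :=
  is_hom h /\ (forall x y, h x = h y -> x = y) /\
  (forall r a, rint B r (fun i => h (a i)) -> rint A r a).

Arguments is_emb {A B} h.
Definition is_iso A B (h : A -> B) : Prop :=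
  is_emb h /\ (forall y, exists x, h x = y).

Arguments is_hom {A B} h.
Arguments is_emb {A B} h.
Arguments is_iso {A B} h.
Definition isomorphic A B : Prop := exists h : A -> B, is_iso h.

Definition closed A (P : A -> Prop) : Prop :=
  forall f a, (forall i, P (a i)) -> P (fint A f a).

Arguments closed {A} P.
Definition sub A (P : A -> Prop) (hP : closed P) : structure S :=
  {| carrier := {x : A | P x};
     fint := fun f a => exist P (fint A f (fun i => proj1_sig (a i)))
                               (hP f _ (fun i => proj2_sig (a i)));
     rint := fun r a => rint A r (fun i => proj1_sig (a i)) |}.

Definition generated_by A (l : list A) (P : A -> Prop) : Prop :=
  closed P /\ (forall x, In x l -> P x) /\
  (forall Q, closed Q -> (forall x, In x l -> Q x) -> forall x, P x -> Q x).

Arguments sub {A P} hP.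
Arguments generated_by {A} l P.
Definition fg_sub A (P : A -> Prop) : Prop := exists l, generated_by l P.

Arguments fg_sub {A} P.
Definition fin_gen A : Prop := fg_sub (fun _ : A => True).

Definition countable A : Prop :=
  exists e : A -> nat, forall x y, e x = e y -> x = y.

Definition fg_subs_in (C : structure S -> Prop) A : Prop :=
  forall (P : A -> Prop) (hP : closed P), fg_sub P ->
    exists D, C D /\ isomorphic (sub hP) D.

Definition JEP (C : structure S -> Prop) : Prop :=
  forall A B, C A -> C B -> exists D, C D /\
    (exists g : A -> D, is_emb g) /\ (exists g : B -> D, is_emb g).

Definition is_age (C : structure S -> Prop) : Prop :=
  (forall A, C A -> fin_gen A) /\
  (exists e : nat -> structure S, forall A, C A -> exists n, isomorphic A (e n)) /\
  (forall A, C A -> fg_subs_in C A) /\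
  JEP C.

Definition Cbar (C : structure S -> Prop) A : Prop := countable A /\ fg_subs_in C A.

Definition AP (C : structure S -> Prop) : Prop :=
  forall A B1 B2 (f1 : A -> B1) (f2 : A -> B2), C A -> C B1 -> C B2 ->
    is_emb f1 -> is_emb f2 ->
    exists (D : structure S) (g1 : B1 -> D) (g2 : B2 -> D), C D /\ is_emb g1 /\ is_emb g2 /\
      forall a, g1 (f1 a) = g2 (f2 a).

Definition fraisse_class (C : structure S -> Prop) : Prop := is_age C /\ AP C.

Definition homogeneous U : Prop :=
  forall (P1 P2 : U -> Prop) (h1 : closed P1) (h2 : closed P2),
    fg_sub P1 -> fg_sub P2 ->
    forall g : sub h1 -> sub h2, is_iso g ->
    exists a : U -> U, is_iso a /\ forall x : sub h1, a (proj1_sig x) = proj1_sig (g x).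

Definition fraisse_limit (C : structure S -> Prop) U : Prop :=
  countable U /\ homogeneous U /\ fg_subs_in C U /\
  (forall A, C A -> exists (P : U -> Prop) (hP : closed P), fg_sub P /\ isomorphic A (sub hP)).

Definition strict (C : structure S -> Prop) : Prop :=
  forall A B1 B2 (f1 : A -> B1) (f2 : A -> B2), C A -> C B1 -> C B2 ->
    is_emb f1 -> is_emb f2 ->
    exists (D : structure S) (g1 : B1 -> D) (g2 : B2 -> D), C D /\ is_hom g1 /\ is_hom g2 /\
      (forall a, g1 (f1 a) = g2 (f2 a)) /\
      (forall (E : structure S) (h1 : B1 -> E) (h2 : B2 -> E), Cbar C E -> is_hom h1 -> is_hom h2 ->
         (forall a, h1 (f1 a) = h2 (f2 a)) ->
         exists u : D -> E, is_hom u /\ (forall b, u (g1 b) = h1 b) /\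
           (forall b, u (g2 b) = h2 b) /\
           (forall u' : D -> E, is_hom u' -> (forall b, u' (g1 b) = h1 b) ->
              (forall b, u' (g2 b) = h2 b) -> forall x, u' x = u x)).

Definition strict_fraisse_class (C : structure S -> Prop) : Prop :=
  fraisse_class C /\ strict C.

Definition HAP (C : structure S -> Prop) : Prop :=
  forall A B1 B2 (f1 : A -> B1) (f2 : A -> B2), C A -> C B1 -> C B2 ->
    is_emb f1 -> is_hom f2 ->
    exists (D : structure S) (g1 : B1 -> D) (g2 : B2 -> D), C D /\ is_hom g1 /\ is_emb g2 /\
      forall a, g1 (f1 a) = g2 (f2 a).

Definition prod_str A B : structure S :=
  {| carrier := (A * B)%type;
     fint := fun f a => (fint A f (fun i => fst (a i)), fint B f (fun i => snd (a i)));
     rint := fun r a => rint A r (fun i => fst (a i)) /\ rint B r (fun i => snd (a i)) |}.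

Definition closed_under_products (C : structure S -> Prop) : Prop :=
  forall A B, C A -> C B -> exists D, C D /\ isomorphic (prod_str A B) D.

Definition countable_copower_exists (C : structure S -> Prop) U : Prop :=
  exists (K : structure S) (iota : nat -> U -> K), Cbar C K /\ (forall n, is_hom (iota n)) /\
    forall (E : structure S) (h : nat -> U -> E), Cbar C E -> (forall n, is_hom (h n)) ->
      exists u : K -> E, is_hom u /\ (forall n x, u (iota n x) = h n x) /\
        (forall u' : K -> E, is_hom u' -> (forall n x, u' (iota n x) = h n x) ->
           forall y, u' y = u y).

Inductive monoid_gen (X : Type) (G : list (X -> X)) : (X -> X) -> Prop :=
| mg_id : forall g, (forall x, g x = x) -> monoid_gen G g
| mg_gen : forall g h, In h G -> (forall x, g x = h x) -> monoid_gen G g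
| mg_comp : forall g h1 h2, monoid_gen G h1 -> monoid_gen G h2 ->
    (forall x, g x = h1 (h2 x)) -> monoid_gen G g.

Definition End_fin_gen U : Prop :=
  exists G : list (U -> U), (forall h, In h G -> is_hom h) /\
    forall g : U -> U, is_hom g -> monoid_gen G g.

Definition power U (n : nat) : structure S :=
  {| carrier := Fin.t n -> U;
     fint := fun f a => fun j => fint U f (fun i => a i j);
     rint := fun r a => forall j, rint U r (fun i => a i j) |}.

End Structures.

Definition op (X : Type) := {n : nat & (Fin.t n -> X) -> X}.

Inductive clo (X : Type) (H : op X -> Prop) : op X -> Prop :=
| clo_H : forall o, H o -> clo H o
| clo_proj : forall n (j : Fin.t n) (g : (Fin.t n -> X) -> X),
    (forall x, g x = x j) -> clo H (existT _ n g)
| clo_comp : forall n m (f : (Fin.t n -> X) -> X) (gs : Fin.t n -> (Fin.t m -> X) -> X)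
    (g : (Fin.t m -> X) -> X),
    clo H (existT _ n f) -> (forall j, clo H (existT _ m (gs j))) ->
    (forall x, g x = f (fun j => gs j x)) -> clo H (existT _ m g).

Section HlevSec.
Variable X : Type.
Fixpoint Hlev (H : op X -> Prop) (k i : nat) : ((Fin.t k -> X) -> X) -> Prop :=
  match i with
  | 0 => fun g => exists j : Fin.t k, forall x, g x = x j
  | S i' => fun g => @Hlev H k i' g \/
      exists n (f : (Fin.t n -> X) -> X) (gs : Fin.t n -> (Fin.t k -> X) -> X),
        H (existT _ n f) /\ (forall j, @Hlev H k i' (gs j)) /\
        forall x, g x = f (fun j => gs j x)
  end.
End HlevSec.
Arguments Hlev {X} H k i _.

Definition bergman (X : Type) (F : op X -> Prop) : Prop :=
  forall H : op X -> Prop,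
    (forall o, H o -> F o) -> (forall o, clo H o <-> F o) ->
    forall k, 1 <= k -> exists n, forall g : (Fin.t k -> X) -> X,
      F (existT _ k g) <-> Hlev H k n g.

Definition Pol (S : signature) (U : structure S) : op U -> Prop :=
  fun o => 1 <= projT1 o /\ @is_hom S (power U (projT1 o)) U (projT2 o).

(* Main.v *)
(** Every countable [K] of the right age has a homomorphism [e : K -> U] through which all
    homomorphisms [K -> U] factor as [h o e] with [h] in [End U]. For [K] the copower of [U] this
    yields fixed endomorphisms [T], [E] such that every sequence [g n] of endomorphisms has the
    form [G o T^n o E]; for [K = U^k] it yields one [k]-ary [c] such that every [k]-ary
    polymorphism is [h o c]. Thus any sequence of [k]-ary polymorphisms is [G o T^n o E o c] for a
    single [G]. If [H] generates [Pol U] but no level [n] exhausts the [k]-ary part, a sequence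
    whose [n]-th term has depth beyond [n + n |T| + |E| + |c|] contradicts this at [n = |G|]. *)

From Stdlib Require Import List Arith Lia Cantor.
From Stdlib Require Import IndefiniteDescription ClassicalEpsilon FunctionalExtensionality PropExtensionality ProofIrrelevance.
From Stdlib Require Fin.
Require Import Defs.

#[local] Arguments is_hom {S A B} h.
#[local] Arguments is_emb {S A B} h.
#[local] Arguments is_iso {S A B} h.
#[local] Arguments sub {S A P} hP.
#[local] Arguments closed {S A} P.
#[local] Arguments generated_by {S A} l P.
#[local] Arguments fg_sub {S A} P.

(** * Choice principles and gluing along increasing chains *)

Lemma fin_uniform_bound (n : nat) (R : Fin.t n -> nat -> Prop) :
  (forall i p q, p <= q -> R i p -> R i q) -> (forall i, exists p, R i p) ->
  exists p, forall i, R i p.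
Proof.
  intros mono. induction n as [|n IH]; intros ex.
  - exists 0. intros i. inversion i.
  - destruct (IH (fun i => R (Fin.FS i))) as [p hp].
    + intros i. apply mono.
    + intros i. apply ex.
    + destruct (ex Fin.F1) as [q hq]. exists (p + q). intros i.
      apply (Fin.caseS' i (fun i => R i (p + q))).
      * apply mono with q; [lia | exact hq].
      * intros j. apply mono with p; [lia | apply hp].
Qed.

(** Dependent choice with stage-dependent invariant and successor relation. It builds the chain of
    partial embeddings and, for a given homomorphism, the chain of its partial factorizations. *)
Lemma indexed_dependent_choice (T : Type) (I : nat -> T -> Prop) (R : nat -> T -> T -> Prop) :
  (exists s, I 0 s) -> (forall n s, I n s -> exists s', I (S n) s' /\ R n s s') ->
  exists f : nat -> T, forall n, I n (f n) /\ R n (f n) (f (S n)).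
Proof.
  intros [s0 h0] step.
  (* The invariant becomes a premise, so that the choice is total; where it fails, the state [s]
     itself is returned. *)
  destruct (functional_choice
    (fun (p : nat * T) s' => I (fst p) (snd p) -> I (S (fst p)) s' /\ R (fst p) (snd p) s'))
    as [F hF].
  { intros [n s]. destruct (classic (I n s)) as [h|h].
    - destruct (step n s h) as [s' hs']. exists s'. intros _. exact hs'.
    - exists s. intros h'. contradiction. }
  set (f := fix f n := match n with 0 => s0 | S m => F (m, f m) end).
  assert (hI : forall n, I n (f n)).
  { induction n as [|n IH]; [exact h0 | apply (hF (n, f n)), IH]. }
  exists f. intros n. split; [apply hI | apply (hF (n, f n)), hI].
Qed.

(** Two stages containing [x] are compared at a common later stage, so the value at [x] does not
    depend on the stage; off the union of the chain the value is [y0]. *)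
Lemma glue_chain (X Y : Type) (y0 : Y) (P : nat -> X -> Prop) (f : nat -> X -> Y) :
  (forall n x, P n x -> P (S n) x) ->
  (forall n x, P n x -> f (S n) x = f n x) ->
  exists g : X -> Y, forall n x, P n x -> g x = f n x.
Proof.
  intros mono coh.
  assert (later : forall n x, P n x -> forall d, P (d + n) x /\ f (d + n) x = f n x).
  { intros n x hx. induction d as [|d [IH1 IH2]]; [now split|].
    split; [now apply mono | simpl; rewrite coh by exact IH1; exact IH2]. }
  destruct (functional_choice (fun x y => forall n, P n x -> y = f n x)) as [g hg].
  - intros x. destruct (classic (exists n, P n x)) as [[n hn]|none].
    + exists (f n x). intros m hm.
      destruct (later n x hn m) as [_ e1]. destruct (later m x hm n) as [_ e2].
      rewrite <- e1, <- e2. f_equal. lia.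
    + exists y0. intros n hn. contradict none. now exists n.
  - exists g. intros n x. apply hg.
Qed.

(** * Homomorphisms, partial homomorphisms and finitely generated substructures *)

Section Structures.
Context {sg : signature}.
Implicit Types A B D K U X Y : structure sg.

Lemma hom_comp {A B D} (g : B -> D) (h : A -> B) :
  is_hom g -> is_hom h -> is_hom (fun x => g (h x)).
Proof.
  intros [gf gr] [hf hr]. split.
  - intros f a. now rewrite hf, gf.
  - intros r a ha. apply (gr r (fun i => h (a i))), hr, ha.
Qed.

Lemma emb_comp {A B D} (g : B -> D) (h : A -> B) :
  is_emb g -> is_emb h -> is_emb (fun x => g (h x)).
Proof.
  intros (gh & gi & gr) (hh & hi & hr). split; [now apply hom_comp|]. split.
  - intros x y e. now apply hi, gi.
  - intros r a ha. apply hr, (gr r (fun i => h (a i))), ha.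
Qed.

Lemma iso_comp {A B D} (g : B -> D) (h : A -> B) :
  is_iso g -> is_iso h -> is_iso (fun x => g (h x)).
Proof.
  intros [ge gs] [he hs]. split; [now apply emb_comp|].
  intros y. destruct (gs y) as [b <-]. destruct (hs b) as [a <-]. now exists a.
Qed.

Lemma emb_cancel {A B D} (g : B -> D) (h : A -> B) :
  is_hom g -> is_hom h -> is_emb (fun x => g (h x)) -> is_emb h.
Proof.
  intros [_ gr] hh (_ & ci & cr). split; [exact hh|]. split.
  - intros x y e. apply ci. now rewrite e.
  - intros r a ha. apply cr, (gr r (fun i => h (a i))), ha.
Qed.

(** Injectivity of [g] makes the pointwise lift of [m] commute with the operations, and reflection
    of relations by [g] makes it preserve them. *)
Lemma factor_emb {A B D} (g : B -> D) (m : A -> D) :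
  is_emb g -> is_hom m -> (forall a, exists b, g b = m a) ->
  exists f : A -> B, is_hom f /\ (is_emb m -> is_emb f) /\ forall a, g (f a) = m a.
Proof.
  intros [[gf gr] [gi ge]] [mf mr] ex.
  destruct (functional_choice (fun a b => g b = m a) ex) as [f hf].
  assert (comp : (fun a => g (f a)) = m) by now apply functional_extensionality.
  assert (hhom : is_hom f).
  { split.
    - intros s a. apply gi. rewrite hf, mf, gf. f_equal.
      apply functional_extensionality. intros i. now rewrite hf.
    - intros r a ha. apply ge. apply mr in ha. revert ha. subst m. exact (fun h => h). }
  exists f. split; [exact hhom|]. split; [|exact hf].
  intros me. apply (emb_cancel g f); [now split | exact hhom | now rewrite comp].
Qed.

Lemma iso_inverse {A B} (h : A -> B) :
  is_iso h -> exists g : B -> A, is_iso g /\ (forall y, h (g y) = y) /\ forall x, g (h x) = x.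
Proof.
  intros [he hs].
  destruct (factor_emb h (fun y : B => y)) as (g & _ & ge & hg); [exact he | now split | exact hs|].
  assert (gh : forall x, g (h x) = x) by (intros x; apply (proj1 (proj2 he)), hg).
  exists g. split; [|now split]. split.
  - apply ge. now repeat split.
  - intros x. now exists (h x).
Qed.

Lemma sub_incl_emb {A} {P : A -> Prop} (hP : closed P) :
  is_emb (fun x : sub hP => proj1_sig x).
Proof.
  repeat split; auto. intros [x px] [y py]. simpl. intros ->. f_equal. apply proof_irrelevance.
Qed.

Definition generated {A} (l : list A) (x : A) : Prop :=
  forall Q : A -> Prop, closed Q -> (forall y, In y l -> Q y) -> Q x.

Lemma generated_spec {A} (l : list A) : generated_by l (generated l).
Proof.
  split; [|split].
  - intros f a ha Q hQ hl. apply hQ. intros i. now apply ha.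
  - intros x hx Q _ hl. now apply hl.
  - intros Q hQ hl x hx. now apply hx.
Qed.

Lemma generated_fg {A} (l : list A) : fg_sub (generated l).
Proof. exists l. apply generated_spec. Qed.

Lemma generated_incl {A} (l l' : list A) x :
  (forall y, In y l -> generated l' y) -> generated l x -> generated l' x.
Proof. intros hl hx. apply hx; [apply generated_spec | exact hl]. Qed.

Lemma fg_closed {A} (P : A -> Prop) : fg_sub P -> closed P.
Proof. intros [l [h _]]. exact h. Qed.

(** A partial homomorphism is a total map constrained only on [P]; maps with growing domains then
    share one type and can be compared and glued directly. *)
Definition hom_on {A B} (P : A -> Prop) (h : A -> B) : Prop :=
  (forall f a, (forall i, P (a i)) -> h (fint A f a) = fint B f (fun i => h (a i))) /\
  (forall r a, (forall i, P (a i)) -> rint A r a -> rint B r (fun i => h (a i))).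

Definition emb_on {A B} (P : A -> Prop) (h : A -> B) : Prop :=
  hom_on P h /\ (forall x y, P x -> P y -> h x = h y -> x = y) /\
  (forall r a, (forall i, P (a i)) -> rint B r (fun i => h (a i)) -> rint A r a).

Lemma hom_on_comp {A B D} (P : B -> Prop) (g : B -> D) (h : A -> B) :
  hom_on P g -> is_hom h -> (forall a, P (h a)) -> is_hom (fun a => g (h a)).
Proof.
  intros [gf gr] [hf hr] hP. split.
  - intros f a. now rewrite hf, gf.
  - intros r a ha. apply (gr r (fun i => h (a i))); auto.
Qed.

Lemma emb_on_comp {A B D} (P : B -> Prop) (g : B -> D) (h : A -> B) :
  emb_on P g -> is_emb h -> (forall a, P (h a)) -> is_emb (fun a => g (h a)).
Proof.
  intros (gh & gi & gr) (hh & hi & hr) hP. split; [now apply (hom_on_comp P)|]. split.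
  - intros x y e. apply hi, gi; auto.
  - intros r a ha. apply hr, (gr r (fun i => h (a i))); auto.
Qed.

Lemma image_fg {A B} (P : A -> Prop) (h : A -> B) :
  fg_sub P -> hom_on P h -> fg_sub (fun y => exists x, P x /\ h x = y).
Proof.
  intros [l (hP & hl & hmin)] [hf hr]. exists (map h l). split; [|split].
  - intros f b hb.
    destruct (functional_choice (fun i x => P x /\ h x = b i) hb) as [a ha].
    exists (fint A f a). split; [apply hP; intros i; apply ha|].
    rewrite hf by (intros i; apply ha). f_equal.
    apply functional_extensionality. intros i. apply ha.
  - intros y hy. apply in_map_iff in hy. destruct hy as (x & <- & hx). exists x. auto.
  - intros Q hQ hlQ y (x & px & <-).
    apply (hmin (fun x => P x /\ Q (h x))); [| |exact px].
    + intros f a ha. split; [apply hP; intros i; apply ha|].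
      rewrite hf by (intros i; apply ha). apply hQ. intros i. apply ha.
    + intros z hz. split; [auto | apply hlQ, in_map, hz].
Qed.

Lemma hom_hom_on {A B} (P : A -> Prop) (h : A -> B) : is_hom h -> hom_on P h.
Proof. intros [hf hr]. split; auto. Qed.

Lemma range_fg {A B} (h : A -> B) :
  fin_gen A -> is_hom h -> fg_sub (fun y => exists x, h x = y).
Proof.
  intros hA hh. destruct (image_fg (fun _ => True) h hA (hom_hom_on _ h hh)) as [l (h1 & h2 & h3)].
  replace (fun y => exists x, h x = y) with (fun y => exists x, True /\ h x = y); [now exists l|].
  apply functional_extensionality. intros y. apply propositional_extensionality. firstorder.
Qed.

Lemma emb_onto_range {A B} (h : A -> B) (hc : closed (fun y => exists x, h x = y)) :
  is_emb h -> exists g : A -> sub hc, is_iso g /\ forall a, proj1_sig (g a) = h a.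
Proof.
  intros he.
  destruct (factor_emb (fun x : sub hc => proj1_sig x) h) as (g & gh & ge & hg).
  - apply sub_incl_emb.
  - apply he.
  - intros a. now exists (exist _ (h a) (ex_intro _ a eq_refl)).
  - exists g. split; [|exact hg]. split; [now apply ge|].
    intros [y [a ea]]. exists a. apply (sub_incl_emb hc). simpl. now rewrite hg.
Qed.

(** Replaces a subset of [X] by an abstract copy [A], typically a member of [C], to which
    amalgamation, the HAP and strictness can be applied. *)
Definition presents {A X} (P : X -> Prop) (phi : A -> X) : Prop :=
  is_emb phi /\ forall x, P x <-> exists a, phi a = x.

Lemma fg_presented {C : structure sg -> Prop} {X} (P : X -> Prop) :
  fg_subs_in C X -> fg_sub P -> exists A (phi : A -> X), C A /\ presents P phi.
Proof.
  intros hX hP. destruct (hX P (fg_closed P hP) hP) as (A & hA & h & hh).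
  destruct (iso_inverse h hh) as (g & [ge gs] & _). exists A, (fun a => proj1_sig (g a)).
  split; [exact hA|]. split.
  - apply (emb_comp (fun x : sub _ => proj1_sig x)); [apply sub_incl_emb | exact ge].
  - intros x. split.
    + intros px. destruct (gs (exist _ x px)) as [a ea]. exists a. now rewrite ea.
    + intros [a <-]. apply proj2_sig.
Qed.

(** Transports [m] to the copy of [A] inside [K], with the default value [u0] elsewhere. This turns
    maps between members of [C] back into partial maps on [K]. *)
Lemma extend_along {A K U} (u0 : U) (P : K -> Prop) (alpha : A -> K) (m : A -> U) :
  presents P alpha -> is_hom m ->
  exists e : K -> U, hom_on P e /\ (is_emb m -> emb_on P e) /\ forall a, e (alpha a) = m a.
Proof.
  intros [[[af ar] [ai ae]] aP] [mf mr].
  destruct (functional_choice (fun x u => forall a, alpha a = x -> u = m a)) as [e he].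
  { intros x. destruct (classic (exists a, alpha a = x)) as [[a <-]|none].
    - exists (m a). intros b eb. now apply ai in eb as ->.
    - exists u0. intros a ea. contradict none. now exists a. }
  assert (hea : forall a, e (alpha a) = m a) by auto.
  assert (lift : forall n (x : Fin.t n -> K), (forall i, P (x i)) ->
    exists a, x = (fun i => alpha (a i)) /\ (fun i => e (x i)) = (fun i => m (a i))).
  { intros n x hx.
    destruct (functional_choice (fun i a => alpha a = x i) (fun i => proj1 (aP _) (hx i))) as [a ha].
    exists a. split; apply functional_extensionality; intros i; [easy|].
    now rewrite <- ha. }
  assert (hom : hom_on P e).
  { split.
    - intros f x hx. destruct (lift _ x hx) as (a & -> & ->). now rewrite <- af, hea, mf.
    - intros r x hx hr. destruct (lift _ x hx) as (a & -> & ->). now apply mr, ae. }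
  exists e. split; [exact hom|]. split; [|exact hea].
  intros (_ & mi & me). split; [exact hom|]. split.
  - intros x y px py. apply aP in px as [a <-]. apply aP in py as [b <-].
    rewrite !hea. intros e'. now apply mi in e' as ->.
  - intros r x hx. destruct (lift _ x hx) as (a & -> & ->). intros hr. now apply ar, me.
Qed.

Lemma sub_fin_gen {X} (P : X -> Prop) (hP : closed P) : fg_sub P -> fin_gen (sub hP).
Proof.
  intros [l (_ & hl & hmin)].
  assert (lift : forall l0, (forall x, In x l0 -> P x) ->
    exists l' : list (sub hP), map (fun x => proj1_sig x) l' = l0).
  { induction l0 as [|x l0 IH]; intros h; [now exists nil|].
    destruct IH as [l' hl']; [intros y hy; apply h; now right|].
    exists (exist _ x (h x (or_introl eq_refl)) :: l'). simpl. now rewrite hl'. }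
  destruct (lift l hl) as [l' <-]. exists l'. split; [easy|]. split; [easy|].
  intros Q hQ hlQ [x px] _.
  (* Minimality is available only for predicates on [X], so the membership proof is quantified away
     and afterwards identified by proof irrelevance. *)
  destruct (hmin (fun x => exists p, Q (exist _ x p))) with (x := x) as [p hp].
  - intros f a ha.
    destruct (functional_choice (fun i (y : sub hP) => proj1_sig y = a i /\ Q y)) as [b hb].
    { intros i. destruct (ha i) as [p hp]. now exists (exist _ (a i) p). }
    replace a with (fun i => proj1_sig (b i))
      by (apply functional_extensionality; intros i; apply hb).
    exists (hP f _ (fun i => proj2_sig (b i))). apply (hQ f b). intros i. apply hb.
  - intros y hy. apply in_map_iff in hy as ([z pz] & <- & hz). exists pz. now apply hlQ.
  - exact px.
  - now rewrite (proof_irrelevance _ px p).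
Qed.

(** * Closure of the structures over [C] under embeddings and finite powers *)

Lemma fin_gen_isomorphic (C : structure sg -> Prop) {A Y} (h : A -> Y) :
  fin_gen A -> is_emb h -> fg_subs_in C Y -> exists D, C D /\ isomorphic A D.
Proof.
  intros hA he hY. assert (hr := range_fg h hA (proj1 he)).
  destruct (hY _ (fg_closed _ hr) hr) as (D & hD & k & hk).
  destruct (emb_onto_range h (fg_closed _ hr) he) as (g & hg & _).
  exists D. split; [exact hD|]. exists (fun a => k (g a)). now apply iso_comp.
Qed.

Lemma fg_subs_in_emb (C : structure sg -> Prop) {X Y} (h : X -> Y) :
  is_emb h -> fg_subs_in C Y -> fg_subs_in C X.
Proof.
  intros he hY P hP hfg. apply (fin_gen_isomorphic C (fun x : sub hP => h (proj1_sig x))).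
  - now apply sub_fin_gen.
  - apply (emb_comp h); [exact he | apply sub_incl_emb].
  - exact hY.
Qed.

(** The coordinates of the generators generate members [D1], [D2] of [C] up to isomorphism. The
    given substructure embeds in their product, which is in [C] up to isomorphism, and heredity
    applies. *)
Lemma fg_subs_in_prod (C : structure sg -> Prop) X Y :
  is_age C -> closed_under_products C ->
  fg_subs_in C X -> fg_subs_in C Y -> fg_subs_in C (prod_str X Y).
Proof.
  intros (_ & _ & hered & _) prods hX hY P hP hfg. destruct (hfg) as [l (_ & hl & hmin)].
  destruct (fg_presented (generated (map fst l)) hX (generated_fg _))
    as (D1 & d1 & hD1 & e1 & im1).
  destruct (fg_presented (generated (map snd l)) hY (generated_fg _))
    as (D2 & d2 & hD2 & e2 & im2).
  destruct (prods D1 D2 hD1 hD2) as (D & hD & k & hk).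
  assert (inside : forall z : prod_str X Y, P z ->
    generated (map fst l) (fst z) /\ generated (map snd l) (snd z)).
  { apply hmin.
    - intros f a ha. split; apply (proj1 (generated_spec _)); intros i; apply ha.
    - intros z hz. split; apply generated_spec; now apply in_map. }
  set (pr := fun z : prod_str D1 D2 => (d1 (fst z), d2 (snd z)) : prod_str X Y).
  assert (pre : is_emb pr).
  { destruct e1 as [[f1 r1] [i1 s1]]. destruct e2 as [[f2 r2] [i2 s2]].
    split; [split|split].
    - intros f a. unfold pr. simpl. now rewrite f1, f2.
    - intros r a [h1 h2]. split; [apply r1, h1 | apply r2, h2].
    - intros [a b] [a' b'] e. injection e as ea eb. f_equal; auto.
    - intros r a [h1 h2]. split; [apply s1, h1 | apply s2, h2]. }
  destruct (factor_emb pr (fun x : sub hP => proj1_sig x)) as (g & gh & ge & hg).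
  - exact pre.
  - apply sub_incl_emb.
  - intros [[x y] pz]. destruct (inside _ pz) as [hx hy].
    apply im1 in hx as [a ea]. apply im2 in hy as [b eb]. exists (a, b).
    unfold pr. simpl in *. now rewrite ea, eb.
  - assert (ke : is_emb (fun x : sub hP => k (g x))).
    { apply emb_comp; [apply hk | apply ge, sub_incl_emb]. }
    now apply (fin_gen_isomorphic C _ (sub_fin_gen P hP hfg) ke), hered.
Qed.

Lemma countable_emb {X Y} (h : X -> Y) : is_emb h -> countable Y -> countable X.
Proof.
  intros (_ & hi & _) [e he]. exists (fun x => e (h x)). intros x y exy. now apply hi, he.
Qed.

Lemma countable_prod X Y : countable X -> countable Y -> countable (prod_str X Y).
Proof.
  intros [e he] [e' he']. exists (fun z => to_nat (e (fst z), e' (snd z))).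
  intros [a b] [a' b'] h. apply to_nat_inj in h. injection h as h1 h2. f_equal; auto.
Qed.

(** Induction along the embeddings of [U^1] into [U] and of [U^(n+2)] into [U * U^(n+1)]. *)
Lemma power_Cbar (C : structure sg -> Prop) U n :
  is_age C -> closed_under_products C -> Cbar C U -> Cbar C (power U (S n)).
Proof.
  intros hage prods [cU hU]. induction n as [|n [IHc IHs]].
  - assert (he : is_emb (fun x : power U 1 => x Fin.F1)).
    { split; [split|split]; simpl; auto.
      - intros x y e. apply functional_extensionality. intros i.
        apply (Fin.caseS' i (fun i => x i = y i)); [exact e | intros j; inversion j].
      - intros r a h i. apply (Fin.caseS' i (fun i => rint U r (fun j => a j i)));
          [exact h | intros j; inversion j]. }
    split; [now apply (countable_emb _ he) | now apply (fg_subs_in_emb C _ he)].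
  - set (h := fun x : power U (S (S n)) =>
      (x Fin.F1, fun i => x (Fin.FS i)) : prod_str U (power U (S n))).
    assert (he : is_emb h).
    { split; [split|split]; simpl.
      - easy.
      - intros r a ha. split; [|intros j]; apply ha.
      - intros x y e. injection e as e0 e1. apply functional_extensionality. intros i.
        apply (Fin.caseS' i (fun i => x i = y i)); [exact e0 | intros j].
        exact (f_equal (fun k => k j) e1).
      - intros r a [h1 h2] i. apply (Fin.caseS' i (fun i => rint U r (fun j => a j i)));
          [exact h1 | exact h2]. }
    split.
    + now apply (countable_emb h he), countable_prod.
    + now apply (fg_subs_in_emb C h he), fg_subs_in_prod.
Qed.

(** * Enumerations and unions of countable chains *)

Lemma countable_enumeration {X} (x0 : X) :
  countable X -> exists s : nat -> X, forall x, exists n, s n = x.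
Proof.
  intros [e he].
  destruct (functional_choice (fun n x => forall y, e y = n -> y = x)) as [s hs].
  - intros n. destruct (classic (exists y, e y = n)) as [[y <-]|none].
    + exists y. intros z. apply he.
    + exists x0. intros y hy. contradict none. now exists y.
  - exists s. intros x. exists (e x). symmetry. now apply hs.
Qed.

Lemma chain_mono {X : Type} (P : nat -> X -> Prop) :
  (forall n x, P n x -> P (S n) x) -> forall m n x, m <= n -> P m x -> P n x.
Proof. intros step m n x hmn hx. induction hmn; auto. Qed.

(** Arities are finite, so all arguments of an operation or relation lie in one common stage, where
    [g] agrees with a partial homomorphism. *)
Lemma chain_hom {X Y} (P : nat -> X -> Prop) (f : nat -> X -> Y) (g : X -> Y) :
  (forall n, closed (P n)) -> (forall n x, P n x -> P (S n) x) -> (forall x, exists n, P n x) ->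
  (forall n, hom_on (P n) (f n)) -> (forall n x, P n x -> g x = f n x) -> is_hom g.
Proof.
  intros hcl mono ex hf hg.
  assert (stage : forall m (a : Fin.t m -> X), exists n, forall i, P n (a i)).
  { intros m a. apply (fin_uniform_bound m (fun i n => P n (a i))).
    - intros i p q. apply (chain_mono P mono).
    - intros i. apply ex. }
  assert (agree : forall m (a : Fin.t m -> X) n, (forall i, P n (a i)) ->
    (fun i => g (a i)) = (fun i => f n (a i))).
  { intros m a n ha. apply functional_extensionality. auto. }
  split.
  - intros s a. destruct (stage _ a) as [n ha].
    rewrite (agree _ a n ha), (hg n) by now apply hcl. now apply hf.
  - intros r a hr. destruct (stage _ a) as [n ha].
    rewrite (agree _ a n ha). now apply hf.
Qed.

(** * Extension properties of the Fraïssé limit and universal homomorphisms into it *)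

Section FraisseLimit.
Context {C : structure sg -> Prop} {U : structure sg} (u0 : U).
Context (hC : strict_fraisse_class C) (hU : fraisse_limit C U).

Lemma limit_Cbar : Cbar C U.
Proof. destruct hU as (h1 & _ & h2 & _). now split. Qed.

Lemma member_emb A : C A -> exists theta : A -> U, is_emb theta.
Proof.
  intros hA. destruct hU as (_ & _ & _ & h). destruct (h A hA) as (P & hP & _ & k & hk).
  exists (fun a => proj1_sig (k a)).
  apply (emb_comp (fun x : sub hP => proj1_sig x)); [apply sub_incl_emb | apply hk].
Qed.

Lemma member_fin_gen A : C A -> fin_gen A.
Proof. apply hC. Qed.

Lemma member_Cbar A : C A -> Cbar C A.
Proof.
  intros hA. split; [|now apply hC]. destruct (member_emb A hA) as [th hth].
  apply (countable_emb th hth), hU.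
Qed.

(** For any embedding [th] of [D] into [U], homogeneity gives an automorphism taking [phi] to [th]
    after [g]; its inverse corrects [th]. *)
Lemma emb_extension {B D} (g : B -> D) (phi : B -> U) :
  C B -> C D -> is_emb g -> is_emb phi ->
  exists psi : D -> U, is_emb psi /\ forall b, psi (g b) = phi b.
Proof.
  intros hB hD hg hphi. destruct (member_emb D hD) as [th hth].
  assert (hthg := emb_comp th g hth hg).
  assert (fg1 := range_fg phi (member_fin_gen B hB) (proj1 hphi)).
  assert (fg2 := range_fg _ (member_fin_gen B hB) (proj1 hthg)).
  destruct (emb_onto_range phi (fg_closed _ fg1) hphi) as (m1 & im1 & hm1).
  destruct (emb_onto_range _ (fg_closed _ fg2) hthg) as (m2 & im2 & hm2).
  destruct (iso_inverse m1 im1) as (m1' & im1' & _ & hm1').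
  destruct hU as (_ & hom & _).
  destruct (hom _ _ _ _ fg1 fg2 (fun x => m2 (m1' x)) (iso_comp _ _ im2 im1')) as (a & ia & ha).
  destruct (iso_inverse a ia) as (a' & ia' & _ & ha').
  exists (fun d => a' (th d)). split; [apply emb_comp; [apply ia' | exact hth]|].
  intros b. rewrite <- (ha' (phi b)). f_equal. rewrite <- (hm1 b), ha, hm1'. symmetry. apply hm2.
Qed.

(** The HAP is applied to the inclusion of [P] in [Q] and to [h] as a map onto its finitely
    generated image. The resulting structure is embedded in [U] so that this image stays in
    place. *)
Lemma hom_extension (hap : HAP C) (P Q : U -> Prop) (h : U -> U) :
  fg_sub P -> fg_sub Q -> (forall y, P y -> Q y) -> hom_on P h ->
  exists h' : U -> U, hom_on Q h' /\ forall y, P y -> h' y = h y.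
Proof.
  intros fgP fgQ hPQ hh. destruct limit_Cbar as [_ hsub].
  destruct (fg_presented P hsub fgP) as (A & al & hA & pA).
  destruct (fg_presented Q hsub fgQ) as (B1 & be & hB1 & pB1).
  destruct (fg_presented _ hsub (image_fg P h fgP hh)) as (B2 & ga & hB2 & pB2).
  destruct (factor_emb be al) as (f1 & _ & ef1 & hf1).
  { apply pB1. } { apply pA. } { intros a. apply pB1, hPQ, pA. now exists a. }
  destruct (factor_emb ga (fun a => h (al a))) as (f2 & hf2 & _ & ef2).
  { apply pB2. }
  { apply (hom_on_comp P); [exact hh | apply pA | intros a; apply pA; now exists a]. }
  { intros a. apply pB2. exists (al a). split; [apply pA; now exists a | reflexivity]. }
  destruct (hap A B1 B2 f1 f2 hA hB1 hB2 (ef1 (proj1 pA)) hf2)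
    as (D & g1 & g2 & hD & hg1 & hg2 & com).
  destruct (emb_extension g2 ga hB2 hD hg2 (proj1 pB2)) as (psi & epsi & hpsi).
  destruct (extend_along u0 Q be (fun b => psi (g1 b)) pB1) as (h' & hh' & _ & eh').
  { apply hom_comp; [apply epsi | exact hg1]. }
  exists h'. split; [exact hh'|]. intros y py. apply (proj2 pA) in py as [a <-].
  now rewrite <- (ef2 a), <- hpsi, <- com, <- eh', hf1.
Qed.

(** Comparing the strict pushout with an amalgam: the mediating map composed with each leg is an
    embedding, hence each leg is one. *)
Lemma pushout_of_embeddings A B1 B2 (f1 : A -> B1) (f2 : A -> B2) :
  C A -> C B1 -> C B2 -> is_emb f1 -> is_emb f2 ->
  exists D (g1 : B1 -> D) (g2 : B2 -> D), C D /\ is_emb g1 /\ is_emb g2 /\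
    (forall a, g1 (f1 a) = g2 (f2 a)) /\
    forall (E : structure sg) (h1 : B1 -> E) (h2 : B2 -> E), Cbar C E -> is_hom h1 -> is_hom h2 ->
      (forall a, h1 (f1 a) = h2 (f2 a)) ->
      exists u : D -> E, is_hom u /\ (forall b, u (g1 b) = h1 b) /\ (forall b, u (g2 b) = h2 b).
Proof.
  intros hA hB1 hB2 e1 e2. destruct hC as [[_ ap] str].
  destruct (str A B1 B2 f1 f2 hA hB1 hB2 e1 e2) as (D & g1 & g2 & hD & hg1 & hg2 & com & univ).
  destruct (ap A B1 B2 f1 f2 hA hB1 hB2 e1 e2) as (E & k1 & k2 & hE & hk1 & hk2 & com').
  destruct (univ E k1 k2 (member_Cbar E hE) (proj1 hk1) (proj1 hk2) com') as (u & hu & u1 & u2 & _).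
  exists D, g1, g2. split; [exact hD|]. split; [|split; [|split; [exact com|]]].
  - apply (emb_cancel u g1 hu hg1). now rewrite (functional_extensionality _ _ u1).
  - apply (emb_cancel u g2 hu hg2). now rewrite (functional_extensionality _ _ u2).
  - intros F h1 h2 hF hh1 hh2 hcom.
    destruct (univ F h1 h2 hF hh1 hh2 hcom) as (v & hv & v1 & v2 & _). now exists v.
Qed.

Lemma extension_step (hap : HAP C) K (A A' : K -> Prop) (D : U -> Prop) (e : K -> U) (u : U) :
  fg_subs_in C K -> fg_sub A -> fg_sub A' -> (forall x, A x -> A' x) ->
  fg_sub D -> emb_on A e -> (forall x, A x -> D (e x)) ->
  exists (D' : U -> Prop) (e' : K -> U),
    fg_sub D' /\ emb_on A' e' /\ (forall x, A' x -> D' (e' x)) /\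
    (forall x, A x -> e' x = e x) /\ (forall y, D y -> D' y) /\ D' u /\
    forall h k : _ -> U, hom_on D h -> is_hom k -> (forall x, A x -> h (e x) = k x) ->
      exists h' : U -> U, hom_on D' h' /\ (forall y, D y -> h' y = h y) /\
        forall x, A' x -> h' (e' x) = k x.
Proof.
  intros hK fgA fgA' hAA' fgD he heD.
  destruct (fg_presented A hK fgA) as (A1 & a1 & hA1 & pA1).
  destruct (fg_presented A' hK fgA') as (A2 & a2 & hA2 & pA2).
  destruct (fg_presented D (proj2 limit_Cbar) fgD) as (D1 & d1 & hD1 & pD1).
  assert (inA : forall a, A (a1 a)) by (intros a; apply pA1; now exists a).
  destruct (factor_emb a2 a1) as (f1 & _ & ef1 & hf1).
  { apply pA2. } { apply pA1. } { intros a. apply pA2, hAA', inA. }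
  assert (ee := emb_on_comp A e a1 he (proj1 pA1) inA).
  destruct (factor_emb d1 (fun a => e (a1 a))) as (f2 & _ & ef2 & hf2).
  { apply pD1. } { apply ee. } { intros a. apply pD1, heD, inA. }
  (* The pushout of [A'] and [D] over [A] is placed in [U] by [psi], which keeps [D] fixed; the new
     [e'] is the leg from [A'] followed by [psi]. *)
  destruct (pushout_of_embeddings A1 A2 D1 f1 f2) as (P & g1 & g2 & hP & eg1 & eg2 & com & univ);
    auto. { apply ef1, pA1. }
  destruct (emb_extension g2 d1 hD1 hP eg2 (proj1 pD1)) as (psi & epsi & hpsi).
  assert (fgI := range_fg psi (member_fin_gen P hP) (proj1 epsi)).
  destruct (fgI) as [l (Icl & hl & lmin)].
  assert (ID : forall y, (exists p, psi p = y) -> generated (u :: l) y).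
  { apply lmin; [apply generated_spec|]. intros y hy. apply generated_spec. now right. }
  destruct (extend_along u0 A' a2 (fun a => psi (g1 a)) pA2) as (e' & _ & ee' & he').
  { apply hom_comp; [apply epsi | apply eg1]. }
  (* Here [l] generates the range of [psi], so the new set contains this range and the prescribed
     point [u]. *)
  exists (generated (u :: l)), e'. split; [apply generated_fg|].
  split; [now apply ee', emb_comp|]. split; [|split; [|split; [|split]]].
  - intros x hx. apply (proj2 pA2) in hx as [a <-]. rewrite he'. apply ID. now exists (g1 a).
  - intros x hx. apply (proj2 pA1) in hx as [a <-].
    now rewrite <- hf1, he', com, hpsi, hf2, hf1.
  - intros y hy. apply (proj2 pD1) in hy as [b <-]. rewrite <- hpsi. apply ID. now exists (g2 b).
  - apply generated_spec. now left.
  - intros h k hh hk hek.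
    destruct (univ U (fun a => k (a2 a)) (fun b => h (d1 b))) as (v & hv & v1 & v2).
    + apply limit_Cbar.
    + apply hom_comp; [exact hk | apply pA2].
    + apply (hom_on_comp D); [exact hh | apply pD1 | intros b; apply pD1; now exists b].
    + intros a. now rewrite hf1, hf2, hek.
    (* The map [v] glued from [h] and [k] is moved to the range of [psi]; the HAP then extends it
       over [u]. *)
    + destruct (extend_along u0 (fun y => exists p, psi p = y) psi v) as (p & hp & _ & ep).
      { now split. } { exact hv. }
      destruct (hom_extension hap _ _ p fgI (generated_fg (u :: l)) ID hp) as (h' & hh' & eh').
      exists h'. split; [exact hh'|]. split.
      * intros y hy. apply (proj2 pD1) in hy as [b <-].
        rewrite <- hpsi, eh' by now exists (g2 b). now rewrite ep, v2, hpsi.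
      * intros x hx. apply (proj2 pA2) in hx as [a <-].
        rewrite he', eh' by now exists (g1 a). now rewrite ep, v1.
Qed.

(** Back-and-forth: exhaust [K] by finitely generated [A n], and [U] by finitely generated [D n]
    containing a copy of [A n], passing from [D n] to [D (S n)] through the pushout of [D n] with
    [A (S n)] (which glues homomorphisms) and then adding the [n]-th point of [U] (over which
    homomorphisms extend by the HAP). *)
Lemma universal_hom (hap : HAP C) K (x0 : K) :
  Cbar C K ->
  exists e : K -> U, is_hom e /\
    forall k : K -> U, is_hom k -> exists h : U -> U, is_hom h /\ forall x, h (e x) = k x.
Proof.
  intros [cK hK].
  destruct (countable_enumeration x0 cK) as [s hs].
  destruct (countable_enumeration u0 (proj1 limit_Cbar)) as [t ht].
  set (A := fun n => generated (map s (seq 0 n))).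
  assert (fgA : forall n, fg_sub (A n)) by (intros n; apply generated_fg).
  assert (monoA : forall n x, A n x -> A (S n) x).
  { intros n x. apply generated_incl. intros y hy. apply generated_spec.
    rewrite seq_S, map_app. apply in_or_app. now left. }
  assert (exA : forall x, exists n, A n x).
  { intros x. destruct (hs x) as [n <-]. exists (S n). apply generated_spec.
    apply in_map, in_seq. lia. }
  (* A state is a pair of [D n] and a partial embedding of [A n] into it. The invariant includes
     that every homomorphism [k] factors over stage [n]; the relation says that every such
     factorization prolongs to the next stage. *)
  destruct (indexed_dependent_choice ((U -> Prop) * (K -> U))
    (fun n st => fg_sub (fst st) /\ emb_on (A n) (snd st) /\
      (forall x, A n x -> fst st (snd st x)) /\
      forall k : K -> U, is_hom k ->
        exists h : U -> U, hom_on (fst st) h /\ forall x, A n x -> h (snd st x) = k x)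
    (fun n st st' => (forall x, A n x -> snd st' x = snd st x) /\
      (forall y, fst st y -> fst st' y) /\ fst st' (t n) /\
      forall h k : _ -> U, hom_on (fst st) h -> is_hom k ->
        (forall x, A n x -> h (snd st x) = k x) ->
        exists h' : U -> U, hom_on (fst st') h' /\ (forall y, fst st y -> h' y = h y) /\
          forall x, A (S n) x -> h' (snd st' x) = k x)) as [f hf].
  (* [A 0] is generated by the empty list and may still contain constants; [D 0] is a copy of it in
     [U]. *)
  { destruct (fg_presented (A 0) hK (fgA 0)) as (B & al & hB & pB).
    destruct (member_emb B hB) as [th hth].
    destruct (extend_along u0 (A 0) al th pB (proj1 hth)) as (e & _ & ee & he).
    exists (fun y => exists b, th b = y, e). simpl. split; [|split; [|split]].
    - now apply range_fg; [apply member_fin_gen | apply hth].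
    - now apply ee.
    - intros x hx. apply (proj2 pB) in hx as [b <-]. now exists b.
    - intros k hk.
      destruct (extend_along u0 (fun y => exists b, th b = y) th (fun b => k (al b)))
        as (h & hh & _ & eh).
      { now split. } { apply hom_comp; [exact hk | apply pB]. }
      exists h. split; [exact hh|]. intros x hx. apply (proj2 pB) in hx as [b <-].
      now rewrite he, eh. }
  { intros n [D e] (fgD & he & heD & hext). simpl in *.
    destruct (extension_step hap K (A n) (A (S n)) D e (t n))
      as (D' & e' & c1 & c2 & c3 & c4 & c5 & c6 & c7); auto.
    exists (D', e'). simpl. split; [|now repeat split].
    split; [exact c1|]. split; [exact c2|]. split; [exact c3|].
    intros k hk. destruct (hext k hk) as (h & hh & eh).
    destruct (c7 h k hh hk eh) as (h' & h1 & _ & h2). now exists h'. }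
  set (D := fun n => fst (f n)). set (eps := fun n => snd (f n)).
  assert (monoD : forall n y, D n y -> D (S n) y) by (intros n; apply (hf n)).
  assert (exD : forall y, exists n, D n y).
  { intros y. destruct (ht y) as [n <-]. exists (S n). apply (hf n). }
  destruct (glue_chain K U u0 A eps monoA) as [e he].
  { intros n. apply (hf n). }
  exists e. split.
  - apply (chain_hom A eps); auto.
    + intros n. apply fg_closed, fgA.
    + intros n. apply (hf n).
  - intros k hk.
    (* The states fix no factorization, so for each [k] a coherent chain of them is chosen
       separately and glued. *)
    destruct (indexed_dependent_choice (U -> U)
      (fun n h => hom_on (D n) h /\ forall x, A n x -> h (eps n x) = k x)
      (fun n h h' => forall y, D n y -> h' y = h y)) as [q hq].
    + destruct (hf 0) as [(_ & _ & _ & h0) _]. exact (h0 k hk).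
    + intros n h [hh eh]. destruct (hf n) as [_ (_ & _ & _ & next)].
      destruct (next h k hh hk eh) as (h' & h1 & h2 & h3). now exists h'.
    + destruct (glue_chain U U u0 D q monoD) as [h hh].
      { intros n. apply (hq n). }
      exists h. split.
      * apply (chain_hom D q); auto.
        -- intros n. apply fg_closed, (hf n).
        -- intros n. apply (hq n).
      * intros x. destruct (exA x) as [n hx]. rewrite (he n x hx), (hh n).
        -- now apply (hq n).
        -- now apply (hf n).
Qed.

(** With [i n] the coprojections of the copower and [e] its universal homomorphism into [U],
    [Gen] extends the cotupling of the [g n] and [T] the shift, so [e i_n = T^n e i_0]. *)
Lemma endomorphism_sequences (hap : HAP C) :
  countable_copower_exists C U ->
  exists T E : U -> U, is_hom T /\ is_hom E /\
    forall g : nat -> U -> U, (forall n, is_hom (g n)) ->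
      exists Gen : U -> U, is_hom Gen /\ forall n x, Gen (Nat.iter n T (E x)) = g n x.
Proof.
  intros (K & i & hK & hi & univ).
  destruct (universal_hom hap K (i 0 u0) hK) as (e & he & hext).
  destruct (univ K (fun n => i (S n)) hK (fun n => hi (S n))) as (sh & hsh & esh & _).
  destruct (hext (fun y => e (sh y)) (hom_comp _ _ he hsh)) as (T & hT & eT).
  exists T, (fun x => e (i 0 x)). split; [exact hT|]. split; [now apply hom_comp|].
  assert (iterT : forall n x, Nat.iter n T (e (i 0 x)) = e (i n x)).
  { induction n as [|n IH]; intros x; simpl; [reflexivity|]. now rewrite IH, eT, esh. }
  intros g hg. destruct (univ U g limit_Cbar hg) as (u & hu & eu & _).
  destruct (hext u hu) as (Gen & hGen & eGen).
  exists Gen. split; [exact hGen|]. intros n x. now rewrite iterT, eGen, eu.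
Qed.

End FraisseLimit.
End Structures.

(** * Depth over a generating set and the diagonal argument *)

Lemma Hlev_mono {X} (H : op X -> Prop) k i j g : i <= j -> Hlev H k i g -> Hlev H k j g.
Proof. intros hij hg. induction hij; [exact hg | now left]. Qed.

(** Depths add under composition: by induction on the depth of [f], the inner operations are
    substituted into the projections at the leaves. *)
Lemma Hlev_comp {X} (H : op X -> Prop) n m i j (f : (Fin.t n -> X) -> X)
    (gs : Fin.t n -> (Fin.t m -> X) -> X) :
  Hlev H n i f -> (forall l, Hlev H m j (gs l)) -> Hlev H m (i + j) (fun x => f (fun l => gs l x)).
Proof.
  intros hf hgs. revert f hf. induction i as [|i IH]; intros f hf; simpl in *.
  - destruct hf as [l hl]. replace (fun x => f (fun l => gs l x)) with (gs l); [apply hgs|].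
    apply functional_extensionality. intros x. now rewrite hl.
  - destruct hf as [hf|(p & f0 & gs0 & hf0 & hgs0 & e)]; [now left; apply IH|].
    right. exists p, f0, (fun q x => gs0 q (fun l => gs l x)). auto.
Qed.

(** Projections have depth 0 and generators depth at most 1; in a composition the finitely many
    inner operations share a depth bound, which is added to the outer depth. *)
Lemma clo_Hlev {X} (H : op X -> Prop) o : clo H o -> exists i, Hlev H (projT1 o) i (projT2 o).
Proof.
  induction 1 as [[n f] ho | n j g hg | n m f gs g _ [i hi] _ IH hg]; simpl in *.
  - exists 1. right. exists n, f, (fun j x => x j). split; [exact ho|]. split; [|reflexivity].
    intros j. now exists j.
  - exists 0. now exists j.
  - destruct (fin_uniform_bound n (fun l p => Hlev H m p (gs l))) as [p hp].
    + intros l a b. apply Hlev_mono.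
    + exact IH.
    + exists (i + p). rewrite (functional_extensionality _ _ hg). now apply Hlev_comp.
Qed.

Lemma Hlev_clo {X} (H : op X -> Prop) k i g : Hlev H k i g -> clo H (existT _ k g).
Proof.
  revert g. induction i as [|i IH]; simpl; intros g.
  - intros [j hj]. now apply clo_proj with j.
  - intros [hg|(n & f & gs & hf & hgs & e)]; [now apply IH|].
    apply clo_comp with n f gs; auto. now apply clo_H.
Qed.

(** The constant [d] is a depth of [T] as a unary polymorphism, so it depends neither on [g] nor on
    its arity. *)
Lemma unary_Hlev {sg : signature} {U : structure sg} (H : op U -> Prop) (T : U -> U) :
  (forall o, clo H o <-> Pol U o) -> is_hom T ->
  exists d, forall k i g, Hlev H k i g -> Hlev H k (d + i) (fun x => T (g x)).
Proof.
  intros gen [hf hr].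
  destruct (clo_Hlev H (existT _ 1 (fun x : Fin.t 1 -> U => T (x Fin.F1)))) as [d hd].
  { apply gen. split; [auto|]. split.
    - intros f a. apply hf.
    - intros r a ha. apply (hr r (fun j => a j Fin.F1)), ha. }
  exists d. intros k i g hg. exact (Hlev_comp H _ k d i _ (fun _ => g) hd (fun _ => hg)).
Qed.

Theorem theorem7p7 (S : signature) (C : structure S -> Prop) (U : structure S) :
  strict_fraisse_class C -> fraisse_limit C U ->
  closed_under_products C -> HAP C -> countable_copower_exists C U ->
  ~ End_fin_gen U ->
  bergman (Pol U).
Proof.
  intros hC hU prods hap cop nfg.
  (* On an empty [U] every endomorphism is the identity, so the empty list would generate
     [End U]. *)
  assert (inh : exists u0 : U, True).
  { apply NNPP. intros empty. apply nfg. exists nil. split; [intros h []|].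
    intros g _. apply mg_id. intros x. contradict empty. now exists x. }
  destruct inh as [u0 _].
  intros H hH gen [|k] hk; [lia|].
  destruct (endomorphism_sequences u0 hC hU hap cop) as (T & E & hT & hE & seqs).
  destruct (universal_hom u0 hC hU hap (power U (1 + k)) (fun _ => u0)) as (c & hc & hext).
  { apply power_Cbar; [apply hC | exact prods | now apply limit_Cbar]. }
  destruct (unary_Hlev H T gen hT) as [dT HT].
  destruct (unary_Hlev H E gen hE) as [dE HE].
  destruct (clo_Hlev H (existT _ (1 + k) c)) as [dc hdc].
  { apply gen. split; [simpl; lia | exact hc]. }
  apply NNPP. intros unbounded.
  (* Every level lies in [Pol U], so a level that differs from the [k]-ary part misses some
     polymorphism. *)
  destruct (functional_choice (fun n g => Pol U (existT _ (1 + k) g) /\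
    ~ Hlev H (1 + k) (n + (n * dT + (dE + dc))) g)) as [g hg].
  { intros n. apply NNPP. intros none. apply unbounded.
    exists (n + (n * dT + (dE + dc))). intros g. split.
    - intros pg. apply NNPP. intros ng. apply none. now exists g.
    - intros lg. apply gen. now apply Hlev_clo in lg. }
  destruct (functional_choice (fun n (G : U -> U) => is_hom G /\ forall x, G (c x) = g n x))
    as [G hG].
  { intros n. apply hext. apply (hg n). }
  destruct (seqs G) as (Gen & hGen & eGen). { intros n. apply (hG n). }
  (* The cost [d] of [Gen] is known only after the whole sequence is fixed; the summand [n] in the
     chosen bound absorbs it at index [d]. *)
  destruct (unary_Hlev H Gen gen hGen) as [d HGen].
  apply (proj2 (hg d)).
  replace (g d) with (fun x => Gen (Nat.iter d T (E (c x)))).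
  2:{ apply functional_extensionality. intros x. rewrite eGen. apply (hG d). }
  apply HGen. clear - HT HE hdc. induction d as [|d IH]; simpl.
  - now apply HE.
  - rewrite <- Nat.add_assoc. now apply (HT _ _ (fun x => Nat.iter d T (E (c x)))).
Qed.
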